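(* Let $\alpha_t\in(0,1)$ with $\gamma_1/\gamma_2\le\alpha_t$ and let $u_t\in\{0,1\}^{N_{\mathrm{HVAC}}}$. The distributionally robust chance constraint $$\inf_{f\in\mathcal D_t^1}\mathbb P_f\Big(\sum_{\ell=1}^{N_{\mathrm{HVAC}}}P_\ell u_{t,\ell}-\sum_{i=1}^{N_{\mathrm{PV}}}\widetilde P_{\mathrm{PV},t,i}\ge0\Big)\ge1-\alpha_t,$$ or equivalently $$\sum_{\ell=1}^{N_{\mathrm{HVAC}}}P_\ell u_{t,\ell}\ge\theta_t+\Big(\sqrt{\gamma_1}+\sqrt{\tfrac{1-\alpha_t}{\alpha_t}(\gamma_2-\gamma_1)}\Big)\sigma_t,$$ holds if and only if there exist $d\in\mathbb R$ and $g\in\mathbb R^{N_{\mathrm{HVAC}}\times N_{\mathrm{HVAC}}}$ such that $$\left\|\begin{pmatrix}2\sigma_t\sqrt{\gamma_2-\gamma_1}\\ \alpha_t-d\end{pmatrix}\right\|_2\le\alpha_t+d,$$ $$d\le\sum_{i,j=1}^{N_{\mathrm{HVAC}}}P_iP_jg_{ij}-2(\theta_t+\sigma_t\sqrt{\gamma_1})\sum_{\ell=1}^{N_{\mathrm{HVAC}}}P_\ell u_{t,\ell}+\theta_t^2+2\theta_t\sigma_t\sqrt{\gamma_1}+\gamma_2\sigma_t^2,$$ $$\sum_{\ell=1}^{N_{\mathrm{HVAC}}}P_\ell u_{t,\ell}\ge\theta_t+\sigma_t\sqrt{\gamma_1},$$ $$g_{ij}\ge u_{t,i}+u_{t,j}-1,\quad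 g_{ij}\le u_{t,i},\quad g_{ij}\le u_{t,j},\quad g_{ij}\ge0,\qquad i,j=1,\ldots,N_{\mathrm{HVAC}}.$$
   Context: $N_{\mathrm{HVAC}},N_{\mathrm{PV}}\ge1$ are integers, $P_\ell>0$ is the energy consumption of unit $\ell$, and $t$ is a fixed period. $\widetilde P_{\mathrm{PV},t}$ is a random vector in $\mathbb R^{N_{\mathrm{PV}}}$ with distribution $f$; $\mathbb P_f,\mathbb E_f$ denote probability and expectation under $f$. Given $\mu_t\in\mathbb R^{N_{\mathrm{PV}}}$, a positive definite matrix $\Sigma_t$ (the empirical mean and covariance of samples), and $\gamma_1\ge0$, $\gamma_2\ge\max\{\gamma_1,1\}$, the moment-based ambiguity set $\mathcal D_t^1$ is the set of all distributions $f$ with $\mathbb P_f(\widetilde P_{\mathrm{PV},t}\in\mathbb R^{N_{\mathrm{PV}}})=1$, $(\mathbb E_f[\widetilde P_{\mathrm{PV},t}]-\mu_t)^\top\Sigma_t^{-1}(\mathbb E_f[\widetilde P_{\mathrm{PV},t}]-\mu_t)\le\gamma_1$, and $\mathbb E_f[(\widetilde P_{\mathrm{PV},t}-\mu_t)(\widetilde P_{\mathrm{PV},t}-\mu_t)^\top]\preceq\gamma_2\Sigma_t$. Put $\theta_t=\mathbf 1^\top\mu_t$ and $\sigma_t=\sqrt{\mathbf 1^\top\Sigma_t\mathbf 1}$, where $\mathbf 1$ is the all-ones vector. *)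

(* Defs.v *)
From mathcomp Require Export all_boot all_order all_algebra.
From mathcomp Require Export all_classical all_reals all_analysis.

Set Implicit Arguments.
Unset Strict Implicit.
Unset Printing Implicit Defensive.

Export Order.TTheory GRing.Theory Num.Theory.
Export numFieldNormedType.Exports.

Local Open Scope classical_set_scope.
Local Open Scope ring_scope.

Definition borel_vec (R : realType) (n : nat) :=
  g_sigma_algebraType (@open 'cV[R]_n).

(* The norm MathComp-Analysis puts on matrices is the sup norm. *)
Definition norm2 (R : realType) (n : nat) (v : 'cV[R]_n) : R :=
  Num.sqrt (\sum_i v i 0 ^+ 2).

Definition ones (R : realType) (n : nat) : 'cV[R]_n := const_mx 1.

Definition quad_form (R : realType) (n : nat) (A : 'M[R]_n) (x : 'cV[R]_n) : R :=
  (x^T *m A *m x) 0 0.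

Definition posdef (R : realType) (n : nat) (A : 'M[R]_n) : Prop :=
  A^T = A /\ forall x : 'cV[R]_n, x != 0 -> 0 < quad_form A x.

Definition possemidef (R : realType) (n : nat) (A : 'M[R]_n) : Prop :=
  A^T = A /\ forall x : 'cV[R]_n, 0 <= quad_form A x.

Definition loewner_le (R : realType) (n : nat) (A B : 'M[R]_n) : Prop :=
  possemidef (B - A).

(* Every entry of E_f[X] and E_f[(X - mu)(X - mu)^T] exists and is finite.
   [fine] sends infinite expectations to 0, so [mean_vec] and
   [second_moment] are meaningful only under this condition. *)
Definition has_moments (R : realType) (n : nat)
    (f : probability (borel_vec R n) R) (mu : 'cV[R]_n) : Prop :=
  (forall i : 'I_n,
     f.-integrable [set: borel_vec R n] (fun x => (x i 0)%:E)) /\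
  (forall i j : 'I_n,
     f.-integrable [set: borel_vec R n]
       (fun x => (((x - mu) *m (x - mu)^T) i j)%:E)).

Definition mean_vec (R : realType) (n : nat)
    (f : probability (borel_vec R n) R) : 'cV[R]_n :=
  \col_i fine 'E_f[fun x : borel_vec R n => (x i 0)%R]%E.

Definition second_moment (R : realType) (n : nat)
    (f : probability (borel_vec R n) R) (mu : 'cV[R]_n) : 'M[R]_n :=
  \matrix_(i, j)
    fine 'E_f[fun x : borel_vec R n => (((x - mu) *m (x - mu)^T) i j)%R]%E.

Definition ambiguity_set (R : realType) (n : nat) (mu : 'cV[R]_n)
    (Sigma : 'M[R]_n) (gamma1 gamma2 : R) :
    set (probability (borel_vec R n) R) :=
  [set f : probability (borel_vec R n) R | [/\ f [set: borel_vec R n] = 1%E,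
    has_moments f mu,
    quad_form (invmx Sigma) (mean_vec f - mu) <= gamma1 &
    loewner_le (second_moment f mu) (gamma2 *: Sigma)]].

(* Main.v *)
From HB Require Import structures.
Require Import Defs.
From mathcomp Require Import measurable_realfun ring lra.

(** Only the total of the random vector enters the constraint.  Write Y for its
    deviation from theta, S = sigma ^ 2, a = sqrt (gamma1 S) and
    V = (gamma2 - gamma1) S.  By Cauchy-Schwarz for Sigma, membership in the
    ambiguity set forces (E Y) ^ 2 <= a ^ 2 and E Y ^ 2 <= a ^ 2 + V, and
    conversely any law of Y satisfying these two bounds is realised in the
    ambiguity set by moving along the single direction Sigma 1
    ([ambiguity_total_dev], [two_point_ambiguity]).  The chance constraint says
    P (Y > b) <= alpha for all these laws, with b = load - theta; the claim is
    that this means a + t <= b, where t is the positive root of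
    alpha t ^ 2 = (1 - alpha) V ([robust_tail]).

    Sufficiency is a one-sided Chebyshev bound: for c < b,
    (b - c) ^ 2 P (Y > b) <= E (Y - c) ^ 2.  The choice c = a - V / t is the
    lower atom of the extremal law, so the bound is exactly alpha at b = a + t.
    The mean of Y is only known to be at most a, hence the bound
    - 2 c E Y <= - 2 c a, which needs c <= 0; that inequality is precisely
    gamma1 <= alpha gamma2.

    Necessity: the law with atoms a + t, of mass alpha, and a - V / t has mean a
    and variance V.  If b < a + t, replacing alpha by a slightly larger p keeps
    b strictly below the upper atom, whose mass p > alpha violates the
    constraint.

    For the reformulation, the inequalities on g force g i j = u i * u j for
    binary u, so the double sum is load ^ 2 and the right-hand side of the bound
    on d is r ^ 2 + V with r = load - theta - a.  The cone constraint says
    V <= alpha d, so a feasible d exists exactly when r >= 0 and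
    V <= alpha (r ^ 2 + V), which is t <= r. *)

Set Implicit Arguments.
Unset Strict Implicit.
Unset Printing Implicit Defensive.

Local Open Scope classical_set_scope.
Local Open Scope ring_scope.

(** * Quadratic forms *)

Lemma scalemx_entry (R : nzRingType) (m n : nat) (a : R) (A : 'M[R]_(m, n))
    (i : 'I_m) (j : 'I_n) :
  (a *: A) i j = a * A i j.
Proof. exact: mxE. Qed.

Lemma quad_form_linear (R : realType) (n : nat) (A B : 'M[R]_n) (a b : R)
    (x : 'cV[R]_n) :
  quad_form (a *: A - b *: B) x = a * quad_form A x - b * quad_form B x.
Proof.
rewrite /quad_form mulmxBr mulmxBl -!scalemxAr -!scalemxAl.
by rewrite mxE [X in _ + X]mxE !scalemx_entry.
Qed.

Lemma quad_form_outer (R : realType) (n : nat) (x y : 'cV[R]_n) :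
  quad_form (y *m y^T) x = ((x^T *m y) 0 0) ^+ 2.
Proof.
rewrite /quad_form mulmxA -(mulmxA (x^T *m y)) mxE big_ord1 expr2.
by congr (_ * _); rewrite -[in LHS](trmxK x) -trmx_mul mxE.
Qed.

Lemma posdef_unitmx (R : realType) (n : nat) (A : 'M[R]_n) :
  posdef A -> A \in unitmx.
Proof.
move=> [_ A_gt0]; rewrite -row_free_unit -kermx_eq0.
apply/negPn/negP => /rowV0Pn[v vA v0].
have := A_gt0 v^T; rewrite trmx_eq0 => /(_ v0).
by rewrite /quad_form trmxK (sub_kermxP vA) mul0mx mxE ltxx.
Qed.

(** The form is nonnegative at q x - B y, where B is the mixed term and q the
    value at y; its value there is q (q A(x) - B ^ 2). *)
Lemma posdef_cauchy_schwarz (R : realType) (n : nat) (A : 'M[R]_n)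
    (x y : 'cV[R]_n) : posdef A ->
  ((x^T *m A *m y) 0 0) ^+ 2 <= quad_form A x * quad_form A y.
Proof.
move=> [AT A_gt0]; have [->|y0] := eqVneq y 0.
  by rewrite /quad_form !mulmx0 mxE expr0n mulr0.
have qy := A_gt0 _ y0.
have symB : (y^T *m A *m x) 0 0 = (x^T *m A *m y) 0 0.
  have -> : x^T *m A *m y = (y^T *m A *m x)^T.
    by rewrite !trmx_mul trmxK AT mulmxA.
  by rewrite [RHS]mxE.
set B := (x^T *m A *m y) 0 0 in symB *; set q := quad_form A y in qy *.
have : 0 <= quad_form A (q *: x - B *: y).
  have [->|/A_gt0/ltW//] := eqVneq (q *: x - B *: y) 0.
  by rewrite /quad_form mulmx0 mxE.
have -> : quad_form A (q *: x - B *: y) = q * (q * quad_form A x - B ^+ 2).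
  rewrite /quad_form [(_ - _)^T]linearB /= ![(_ *: _)^T]linearZ /= !mulmxBl.
  rewrite !mulmxBr -!scalemxAl -!scalemxAr.
  have entry (M N K L : 'M[R]_1) s t :
      (s *: (s *: M) - s *: (t *: N) - (t *: (s *: K) - t *: (t *: L))) 0 0 =
      s * (s * M 0 0) - s * (t * N 0 0) - (t * (s * K 0 0) - t * (t * L 0 0)).
    by rewrite !mxE.
  rewrite entry symB -/B /quad_form -/B -/(quad_form A y) -/q; ring.
by rewrite pmulr_rge0// subr_ge0 mulrC.
Qed.

Lemma quad_form_ones (R : realType) (n : nat) (A : 'M[R]_n) :
  quad_form A (ones R n) = \sum_i \sum_j A i j.
Proof.
rewrite /quad_form mxE exchange_big /=; apply: eq_bigr => j _.
by rewrite !mxE mulr1; apply: eq_bigr => i _; rewrite !mxE mul1r.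
Qed.

Lemma ones_dot (R : realType) (n : nat) (x : 'cV[R]_n) :
  ((ones R n)^T *m x) 0 0 = \sum_i x i 0.
Proof. by rewrite mxE; apply: eq_bigr => i _; rewrite !mxE mul1r. Qed.

(** Cauchy-Schwarz for A applied to the all-ones vector and A^-1 w. *)
Lemma sum_sqr_le_quad_form_invmx (R : realType) (n : nat) (A : 'M[R]_n)
    (w : 'cV[R]_n) : posdef A ->
  (\sum_i w i 0) ^+ 2 <= quad_form A (ones R n) * quad_form (invmx A) w.
Proof.
move=> Apd; have Au := posdef_unitmx Apd; have [AT _] := Apd.
have := posdef_cauchy_schwarz (ones R n) (invmx A *m w) Apd.
rewrite -mulmxA mulKVmx// ones_dot /quad_form trmx_mul trmx_inv AT.
by rewrite -!mulmxA mulKVmx.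
Qed.

(** * A one-sided Chebyshev inequality *)

Lemma measurable_upper_level d (T : measurableType d) (R : realType)
    (X : T -> R) (b : R) :
  measurable_fun setT X -> measurable [set x | b < X x].
Proof.
move=> mX; have -> : [set x | b < X x] = setT `&` X @^-1` `]b, +oo[.
  by rewrite setTI; apply/seteqP; split => x /=; rewrite in_itv /= andbT.
exact: mX.
Qed.

Lemma Rintegral_sum d (T : measurableType d) (R : realType)
    (m : {measure set T -> \bar R}) (I : Type) (s : seq I) (h : I -> T -> R) :
  (forall i, m.-integrable setT (EFin \o h i)) ->
  m.-integrable setT (EFin \o (fun x => \sum_(i <- s) h i x)) /\
  \int[m]_x (\sum_(i <- s) h i x) = \sum_(i <- s) \int[m]_x h i x.
Proof.
move=> ih; elim: s => [|i s [IH1 IH2]].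
  under eq_Rintegral do rewrite big_nil.
  rewrite big_nil Rintegral_cst// mul0r; split=> //.
  under eq_fun do rewrite big_nil.
  exact: integrable0.
split.
  under eq_fun do rewrite big_cons.
  exact: integrableD (ih i) IH1.
under eq_Rintegral do rewrite big_cons.
by rewrite RintegralD// IH2 big_cons.
Qed.

(** The indicator of X > b is at most ((X - c) / (b - c)) ^ 2.  The shift c is
    left free because only bounds on the moments of X will be available, and
    the best c is dictated by these bounds rather than by the moments. *)
Lemma one_sided_chebyshev d (T : measurableType d) (R : realType)
    (p : probability T R) (X : T -> R) (b c : R) :
  measurable_fun setT X -> p.-integrable setT (EFin \o X) ->
  p.-integrable setT (EFin \o (fun x => X x ^+ 2)) ->
  c < b ->
  (b - c) ^+ 2 * fine (p [set x | b < X x]) <=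
  \int[p]_x (X x ^+ 2) - 2 * c * \int[p]_x X x + c ^+ 2.
Proof.
move=> mX iX iX2 cb; set A := [set x | b < X x].
have mA : measurable A by exact: measurable_upper_level.
have i1 : p.-integrable setT (EFin \o cst (c ^+ 2)).
  exact: finite_measure_integrable_cst.
have iX' : p.-integrable setT (EFin \o (fun x => - (2 * c) * X x)).
  exact: (integrableZl _ (- (2 * c)) iX).
have iY : p.-integrable setT (EFin \o (fun x => - (2 * c) * X x + c ^+ 2)).
  exact: (integrableD _ iX' i1).
have iZ : p.-integrable setT
    (EFin \o (fun x => X x ^+ 2 + (- (2 * c) * X x + c ^+ 2))).
  exact: (integrableD _ iX2 iY).
have iA : p.-integrable setT (EFin \o (\1_A : T -> R)).
  exact: integrable_indic.
have iB : p.-integrable setT (EFin \o (fun x => (b - c) ^+ 2 * \1_A x)).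
  exact: (integrableZl _ ((b - c) ^+ 2) iA).
have <- : \int[p]_x ((b - c) ^+ 2 * (\1_A x : R)) =
    (b - c) ^+ 2 * fine (p A).
  by rewrite RintegralZl// /Rintegral integral_indic// setIT.
have -> : \int[p]_x (X x ^+ 2) - 2 * c * \int[p]_x X x + c ^+ 2 =
    \int[p]_x (X x ^+ 2 + (- (2 * c) * X x + c ^+ 2)).
  rewrite RintegralD// RintegralD// RintegralZl// Rintegral_cst//.
  by rewrite [X in fine X]probability_setT mulr1 mulNr addrA.
apply: le_Rintegral => // x _.
have -> : X x ^+ 2 + (- (2 * c) * X x + c ^+ 2) = (X x - c) ^+ 2 by ring.
rewrite indicE; case: (boolP (x \in A)) => [|_]; last by rewrite mulr0 sqr_ge0.
rewrite inE /A /= mulr1 => bX.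
by rewrite lerXn2r// ?nnegrE; lra.
Qed.

(** * Moments of the total deviation under an ambiguous law *)

Lemma measurable_coord (R : realType) (n : nat) (i : 'I_n) :
  measurable_fun setT (fun x : borel_vec R n => x i 0).
Proof.
apply: (measurability _ (RGenOpens.measurableE R)).
move=> _ [_ [a [b ->]] <-]; rewrite setTI; apply: sub_sigma_algebra.
have /continuousP := @coord_continuous R n 1 i 0.
by apply; exact: interval_open.
Qed.

Lemma outer_entry (R : realType) (n : nat) (x mu : 'cV[R]_n) (i j : 'I_n) :
  ((x - mu) *m (x - mu)^T) i j = (x i 0 - mu i 0) * (x j 0 - mu j 0).
Proof. by rewrite mxE big_ord1 !mxE. Qed.

Definition total_dev (R : realType) (n : nat) (mu : 'cV[R]_n)
  (x : borel_vec R n) : R := \sum_i (x i 0 - mu i 0).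

Lemma total_devE (R : realType) (n : nat) (mu x : 'cV[R]_n) :
  total_dev mu x = ((ones R n)^T *m (x - mu)) 0 0.
Proof. by rewrite ones_dot; apply: eq_bigr => i _; rewrite !mxE. Qed.

Lemma measurable_total_dev (R : realType) (n : nat) (mu : 'cV[R]_n) :
  measurable_fun setT (total_dev mu).
Proof.
apply: measurable_sum => i; apply: measurable_funB => //.
exact: measurable_coord.
Qed.

Lemma total_dev_mean (R : realType) (n : nat) (mu : 'cV[R]_n)
    (f : probability (borel_vec R n) R) : has_moments f mu ->
  f.-integrable setT (EFin \o total_dev mu) /\
  \int[f]_x total_dev mu x = \sum_i (mean_vec f - mu) i 0.
Proof.
move=> [if1 _].
have ic (r : R) : f.-integrable setT (EFin \o cst r).
  exact: finite_measure_integrable_cst.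
have dev i : f.-integrable setT
    (EFin \o (fun x : borel_vec R n => x i 0 - mu i 0)).
  exact: (integrableB _ (if1 i) (ic (mu i 0))).
have [it ->] := Rintegral_sum (index_enum 'I_n) dev.
split=> //; apply: eq_bigr => i _.
rewrite (RintegralB _ (if1 i) (ic (mu i 0)))// Rintegral_cst//.
rewrite [X in fine X]probability_setT mulr1 !mxE.
by rewrite /Rintegral unlock.
Qed.

Lemma total_dev_second_moment (R : realType) (n : nat) (mu : 'cV[R]_n)
    (f : probability (borel_vec R n) R) : has_moments f mu ->
  f.-integrable setT (EFin \o (fun x => total_dev mu x ^+ 2)) /\
  \int[f]_x (total_dev mu x ^+ 2) = quad_form (second_moment f mu) (ones R n).
Proof.
move=> [_ if2].
have sqrE : (fun x : borel_vec R n => total_dev mu x ^+ 2) =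
    (fun x => \sum_i \sum_j ((x - mu) *m (x - mu)^T) i j).
  apply/funext => x; rewrite expr2 /total_dev mulr_suml.
  apply: eq_bigr => i _; rewrite mulr_sumr; apply: eq_bigr => j _.
  by rewrite outer_entry.
have row i := @Rintegral_sum _ _ _ f _ (index_enum 'I_n)
  (fun j (x : borel_vec R n) => ((x - mu) *m (x - mu)^T) i j) (if2 i).
have [it ite] := Rintegral_sum (index_enum 'I_n) (fun i => (row i).1).
rewrite sqrE; split=> //; rewrite ite quad_form_ones.
apply: eq_bigr => i _; rewrite (row i).2; apply: eq_bigr => j _.
by rewrite mxE /Rintegral unlock.
Qed.

(** The bound on the mean is Cauchy-Schwarz for Sigma; the second one is the
    Loewner inequality tested on the all-ones vector. *)
Lemma ambiguity_total_dev (R : realType) (n : nat) (mu : 'cV[R]_n)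
    (Sigma : 'M[R]_n) (gamma1 gamma2 : R)
    (f : probability (borel_vec R n) R) :
  posdef Sigma -> ambiguity_set mu Sigma gamma1 gamma2 f ->
  (\int[f]_x total_dev mu x) ^+ 2 <= gamma1 * quad_form Sigma (ones R n) /\
  \int[f]_x (total_dev mu x ^+ 2) <= gamma2 * quad_form Sigma (ones R n).
Proof.
move=> Spd [_ mom mean_le [_ second_le]].
have S_ge0 : 0 <= quad_form Sigma (ones R n).
  have [->|/Spd.2/ltW//] := eqVneq (ones R n) 0.
  by rewrite /quad_form mulmx0 mxE.
split.
  rewrite (total_dev_mean mom).2.
  apply: le_trans (sum_sqr_le_quad_form_invmx _ Spd) _.
  by rewrite mulrC ler_wpM2r.
rewrite (total_dev_second_moment mom).2 -subr_ge0.
have := second_le (ones R n).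
by rewrite -[second_moment f mu]scale1r quad_form_linear mul1r scale1r.
Qed.

(** The sign of c matters: the mean of the total is bounded above, so it may be
    replaced by its bound only if its coefficient - 2 c is nonnegative. *)
Lemma total_dev_tail (R : realType) (n : nat) (mu : 'cV[R]_n)
    (Sigma : 'M[R]_n) (gamma1 gamma2 b c : R)
    (f : probability (borel_vec R n) R) :
  posdef Sigma -> ambiguity_set mu Sigma gamma1 gamma2 f ->
  c <= 0 -> c < b ->
  (b - c) ^+ 2 * fine (f [set x | b < total_dev mu x]) <=
  gamma2 * quad_form Sigma (ones R n)
  - 2 * c * Num.sqrt (gamma1 * quad_form Sigma (ones R n)) + c ^+ 2.
Proof.
move=> Spd Df c0 cb.
have [mean_le second_le] := ambiguity_total_dev Spd Df.
have [_ mom _ _] := Df.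
apply: le_trans (one_sided_chebyshev (measurable_total_dev mu)
  (total_dev_mean mom).1 (total_dev_second_moment mom).1 cb) _.
rewrite lerD2r lerD// -!mulNr ler_wpM2l//; first by lra.
apply: le_trans (ler_norm _) _.
by rewrite -sqrtr_sqr ler_wsqrtr.
Qed.

(** * Two-point laws in the ambiguity set *)

Lemma bernoulli_Rintegral (R : realType) (p : R) (g : bool -> R) :
  0 <= p <= 1 ->
  (bernoulli_prob p).-integrable setT (EFin \o g) /\
  \int[bernoulli_prob p]_b g b = p * g true + (1 - p) * g false.
Proof.
move=> p01; split.
  apply: measurable_bounded_integrable => //.
    by rewrite [X in (X < _)%E]probability_setT ltry.
  exists (`|g true| + `|g false|); split; first exact: num_real.
  move=> M ltM [] _ /=; apply: le_trans (ltW ltM).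
    by rewrite lerDl.
  by rewrite lerDr.
rewrite /Rintegral integralE !integral_bernoulli_prob//.
have maxE0 (r : R) : maxe r%:E 0%E = (Num.max r 0)%:E by rewrite EFin_max.
rewrite !funeposE !funenegE /= !maxE0 /unstable.onem -!EFinM -!EFinD /=.
have posneg (r : R) : Num.max r 0 = r + Num.max (- r) 0.
  by case: (leP r 0); case: (leP (- r) 0) => *; lra.
by rewrite (posneg (g true)) (posneg (g false)); ring.
Qed.

Section two_point.
Context {R : realType} {n : nat}.
Variables (p : R) (v w : borel_vec R n).

Let pt (b : bool) : borel_vec R n := if b then v else w.

Let measurable_pt : measurable_fun setT pt.
Proof. by []. Qed.

HB.instance Definition _ := isMeasurableFun.Build _ _ bool (borel_vec R n) pt
  measurable_pt.

(** Being a pushforward of a Bernoulli law, it inherits the structure of a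
    probability measure, and every measurable function is integrable. *)
Definition two_point : probability (borel_vec R n) R :=
  distribution (bernoulli_prob p) pt.

Hypothesis p01 : 0 <= p <= 1.

Lemma two_pointE (A : set (borel_vec R n)) :
  two_point A = (p%:E * \d_v A + (1 - p)%:E * \d_w A)%E.
Proof.
by rewrite /two_point /distribution /= /pushforward bernoulli_probE.
Qed.

Lemma two_point_Rintegral (g : borel_vec R n -> R) : measurable_fun setT g ->
  two_point.-integrable setT (EFin \o g) /\
  \int[two_point]_x g x = p * g v + (1 - p) * g w.
Proof.
move=> mg; have [ig <-] := bernoulli_Rintegral (g \o pt) p01.
have mEg : measurable_fun setT (fun x : borel_vec R n => (g x)%:E).
  exact/measurable_EFinP.
split; last by rewrite /Rintegral integral_distribution.
exact: integrable_pushforward.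
Qed.

End two_point.

Section worst_case.
Context {R : realType} {n : nat}.
Variables (mu : 'cV[R]_n) (Sigma : 'M[R]_n).
Let S := quad_form Sigma (ones R n).
(** Among the directions of total 1, the one on which Sigma^-1 is smallest: the
    equality case of Cauchy-Schwarz. *)
Let dir : 'cV[R]_n := S^-1 *: (Sigma *m ones R n).
Hypotheses (Sigma_pd : posdef Sigma) (S_gt0 : 0 < S).

Lemma total_dev_worst_point (y : R) : total_dev mu (mu + y *: dir) = y.
Proof.
rewrite total_devE addrC addKr -!scalemxAr mulmxA !scalemx_entry.
by rewrite -/(quad_form _ _) mulVf ?mulr1// gt_eqF.
Qed.

(** On the line mu + y [dir] the mean condition reads (E y) ^ 2 <= gamma1 S and
    the Loewner condition follows, by Cauchy-Schwarz for Sigma, from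
    E y ^ 2 <= gamma2 S, so that the constraints on the vector reduce to
    constraints on its total. *)
Lemma two_point_ambiguity (gamma1 gamma2 p y z : R) :
  0 <= p <= 1 ->
  (p * y + (1 - p) * z) ^+ 2 <= gamma1 * S ->
  p * y ^+ 2 + (1 - p) * z ^+ 2 <= gamma2 * S ->
  ambiguity_set mu Sigma gamma1 gamma2
    (two_point p (mu + y *: dir) (mu + z *: dir)).
Proof.
move=> p01; set m := p * y + _; set M := p * y ^+ 2 + _ => mle Mle.
set f := two_point _ _ _.
have M_ge0 : 0 <= M.
  by case/andP: p01 => p0 p1; rewrite addr_ge0// mulr_ge0 ?sqr_ge0// subr_ge0.
have [ST _] := Sigma_pd; have Su := posdef_unitmx Sigma_pd.
have mdev i : measurable_fun setT (fun x : borel_vec R n => x i 0 - mu i 0).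
  by apply: measurable_funB => //; exact: measurable_coord.
have mouter i j : measurable_fun setT
    (fun x : borel_vec R n => ((x - mu) *m (x - mu)^T) i j).
  under eq_fun do rewrite outer_entry.
  exact: measurable_funM.
have meanE : mean_vec f - mu = m *: dir.
  apply/colP => i; rewrite mxE [(- mu) i 0]mxE [LHS]addrC mxE unlock.
  have := (two_point_Rintegral (mu + y *: dir) (mu + z *: dir) p01
    (measurable_coord (R := R) i)).2.
  rewrite /Rintegral => ->; rewrite !mxE /m; ring.
have secondE : second_moment f mu = M *: (dir *m dir^T).
  apply/matrixP => i j; rewrite mxE unlock.
  have := (two_point_Rintegral (mu + y *: dir) (mu + z *: dir) p01
    (mouter i j)).2.
  rewrite /Rintegral => ->; rewrite !outer_entry scalemx_entry.
  rewrite [X in _ = _ * X]mxE big_ord1 !mxE /M; ring.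
split.
- exact: probability_setT.
- split=> [i|i j]; apply: (two_point_Rintegral _ _ p01 _).1 => //.
  exact: measurable_coord.
- rewrite meanE -(ler_pM2r S_gt0); apply: le_trans mle.
  rewrite /quad_form /dir scalerA [(_ *: _)^T]linearZ /= trmx_mul ST.
  rewrite -!scalemxAl -!scalemxAr -!mulmxA mulKVmx// !mulmxA.
  rewrite !scalemx_entry -/(quad_form _ _) -/S.
  by rewrite le_eqVlt; apply/orP; left; apply/eqP; field; rewrite gt_eqF.
- rewrite /loewner_le secondE; split=> [|x].
    have outerT : (dir *m dir^T)^T = dir *m dir^T by rewrite trmx_mul trmxK.
    rewrite [(_ - _)^T]linearB /= [(gamma2 *: _)^T]linearZ /=.
    by rewrite [(M *: _)^T]linearZ /= outerT ST.
  rewrite quad_form_linear quad_form_outer /dir -scalemxAr mulmxA.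
  rewrite !scalemx_entry subr_ge0.
  have CS := posdef_cauchy_schwarz x (ones R n) Sigma_pd.
  set B := (x^T *m Sigma *m _) 0 0 in CS *.
  rewrite -/S in CS.
  have -> : M * (S^-1 * B) ^+ 2 = M * B ^+ 2 / S ^+ 2.
    by field; rewrite gt_eqF.
  rewrite ler_pdivrMr ?exprn_gt0//.
  apply: (@le_trans _ _ (M * (quad_form Sigma x * S))); first exact: ler_wpM2l.
  have -> : gamma2 * quad_form Sigma x * S ^+ 2 =
    (gamma2 * S) * (quad_form Sigma x * S) by ring.
  by apply: ler_wpM2r => //; apply: le_trans CS; exact: sqr_ge0.
Qed.

End worst_case.

(** * Scalar inequalities *)

(** Below, a bounds the mean of the total deviation, V + a ^ 2 its second
    moment, and the threshold to be reached is a + t; the shift a - V / t is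
    the lower atom of the two-point law of mean a and variance V whose upper
    atom a + t has mass alpha. *)
Section scalar.
Context {R : realFieldType}.
Variables (alpha a t V : R).
Hypotheses (alpha_gt0 : 0 < alpha) (t_gt0 : 0 < t) (V_gt0 : 0 < V).
Hypothesis tE : alpha * t ^+ 2 = (1 - alpha) * V.

Lemma optimal_shift_le0 :
  0 <= a -> (1 - alpha) * a ^+ 2 <= alpha * V -> a - V / t <= 0.
Proof.
move=> a0 aV; rewrite subr_le0 ler_pdivlMr//.
have at0 : 0 <= a * t by rewrite mulr_ge0// ltW.
rewrite -(@ler_pXn2r _ 2)// ?nnegrE ?(ltW V_gt0)//.
rewrite -(ler_pM2l alpha_gt0) exprMn mulrCA tE mulrCA [V ^+ 2]expr2 !mulrA.
by rewrite ler_pM2r// -(mulrA (1 - alpha)).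
Qed.

(** Equality holds for b = a + t, since alpha (t + V / t) ^ 2 = V + (V / t) ^ 2,
    and the right-hand side increases with b. *)
Lemma optimal_shift_bound (b : R) : a + t <= b ->
  V + a ^+ 2 - 2 * (a - V / t) * a + (a - V / t) ^+ 2 <=
  alpha * (b - (a - V / t)) ^+ 2.
Proof.
move=> atb.
have q0 : 0 < V / t by rewrite divr_gt0.
have tq : t * (V / t) = V by field; rewrite gt_eqF.
set q : R := V / t in q0 tq *.
have -> : V + a ^+ 2 - 2 * (a - q) * a + (a - q) ^+ 2 = V + q ^+ 2 by ring.
apply: (@le_trans _ _ (alpha * (t + q) ^+ 2)); last first.
  have tq0 : 0 <= t + q by rewrite addr_ge0 ?ltW.
  have tqb : t + q <= b - (a - q).
    rewrite -subr_ge0; have -> : b - (a - q) - (t + q) = b - (a + t) by ring.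
    by rewrite subr_ge0.
  by rewrite ler_pM2l// lerXn2r// nnegrE (le_trans tq0).
have -> : alpha * (t + q) ^+ 2 =
   alpha * t ^+ 2 + 2 * alpha * (t * q) + alpha * q ^+ 2 by ring.
rewrite tE tq.
have /(congr1 (fun x => x * q ^+ 2)) := tE.
have -> : alpha * t ^+ 2 * q ^+ 2 = alpha * V * V by rewrite -tq; ring.
rewrite mulrAC [RHS]mulrAC => /(mulIf (lt0r_neq0 V_gt0)) qE.
by rewrite -subr_ge0 le_eqVlt; apply/orP; left; apply/eqP; lra.
Qed.

End scalar.

(** The upper atom of the extremal law has mass exactly alpha; to exceed alpha
    one perturbs it, which the continuity of sqrt allows. *)
Lemma exists_larger_level (R : rcfType) (alpha V r : R) :
  0 < alpha < 1 -> 0 < V -> r < Num.sqrt ((1 - alpha) / alpha * V) ->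
  exists p, alpha < p < 1 /\ r < Num.sqrt ((1 - p) / p * V).
Proof.
move=> /andP[al0 al1] V0 rt; have [r0|r0] := ltP r 0.
  exists ((1 + alpha) / 2); split; first by apply/andP; split; lra.
  exact: lt_le_trans r0 (sqrtr_ge0 _).
have W0 : 0 < r ^+ 2 + V by rewrite ltr_wpDl// sqr_ge0.
have rsq : r ^+ 2 < (1 - alpha) / alpha * V.
  have X0 : 0 < (1 - alpha) / alpha * V.
    by rewrite mulr_gt0// divr_gt0// subr_gt0.
  rewrite -[ltRHS]sqr_sqrtr ?(ltW X0)//.
  by rewrite ltr_pXn2r// nnegrE ?sqrtr_ge0.
(* For r >= 0 the conclusion amounts to p < q; take a midpoint. *)
set q := V / (r ^+ 2 + V).
have alq : alpha < q.
  rewrite /q ltr_pdivlMr//.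
  move: rsq; rewrite mulrAC ltr_pdivlMr//; lra.
have q1 : q <= 1 by rewrite /q ler_pdivrMr// mul1r lerDr sqr_ge0.
have p0 : 0 < (alpha + q) / 2 by lra.
exists ((alpha + q) / 2); split; first by apply/andP; split; lra.
rewrite -[ltLHS]ger0_norm// -sqrtr_sqr.
have lt : r ^+ 2 < (1 - (alpha + q) / 2) / ((alpha + q) / 2) * V.
  rewrite mulrAC ltr_pdivlMr//.
  have : (alpha + q) / 2 * (r ^+ 2 + V) < q * (r ^+ 2 + V).
    by rewrite ltr_pM2r//; lra.
  rewrite {2}/q divfK ?gt_eqF//; lra.
by rewrite ltr_sqrt//; apply: le_lt_trans lt; exact: sqr_ge0.
Qed.

Lemma norm2_pair_le (R : realType) (x y z : R) :
  norm2 (col_mx x%:M y%:M : 'cV[R]_(1 + 1)) <= z <->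
  0 <= z /\ x ^+ 2 + y ^+ 2 <= z ^+ 2.
Proof.
rewrite /norm2 big_split_ord /= !big_ord1 col_mxEu col_mxEd !mxE !mulr1n.
have s0 : 0 <= x ^+ 2 + y ^+ 2 by rewrite addr_ge0 ?sqr_ge0.
split=> [le|[z0 le]].
  have z0 := le_trans (sqrtr_ge0 _) le; split=> //.
  by rewrite -[leLHS]sqr_sqrtr// ler_pXn2r// nnegrE ?sqrtr_ge0.
by rewrite -[leRHS]ger0_norm// -sqrtr_sqr ler_wsqrtr.
Qed.

(** The difference of the two squares in the cone constraint is 4 alpha d, so
    the constraint says V <= alpha d; the best d is V / alpha. *)
Lemma exists_slack (R : realFieldType) (alpha V t r : R) :
  0 < alpha -> 0 < V -> 0 <= t ->
  alpha * t ^+ 2 = (1 - alpha) * V ->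
  t <= r <->
  exists d, [/\ 0 <= alpha + d /\ 4 * V + (alpha - d) ^+ 2 <= (alpha + d) ^+ 2,
                d <= r ^+ 2 + V & 0 <= r].
Proof.
move=> al0 V0 t0 tE.
have hyp d : (4 * V + (alpha - d) ^+ 2 <= (alpha + d) ^+ 2) = (V <= alpha * d).
  have -> : (alpha + d) ^+ 2 = (alpha - d) ^+ 2 + 4 * (alpha * d) by ring.
  by rewrite addrC lerD2l ler_pM2l.
split=> [tr|[d [[_]]]].
  have dE : alpha * (V / alpha) = V by rewrite mulrC divfK ?gt_eqF.
  exists (V / alpha); rewrite hyp dE lexx; split.
  - by split=> //; rewrite addr_ge0 ?divr_ge0 ?ltW.
  - apply: (@le_trans _ _ (t ^+ 2 + V)).
      by rewrite ler_pdivrMr//; lra.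
    by rewrite lerD2r lerXn2r// nnegrE (le_trans t0).
  - exact: le_trans tr.
rewrite hyp => Vd dr r0; rewrite -(@ler_pXn2r _ 2)// ?nnegrE//.
rewrite -(ler_pM2l al0) tE.
have : alpha * d <= alpha * (r ^+ 2 + V) by rewrite ler_pM2l.
lra.
Qed.

(** The McCormick relaxation of a product is exact at binary points. *)
Lemma mccormick_binary (R : realDomainType) (x y g : R) :
  x = 0 \/ x = 1 -> y = 0 \/ y = 1 ->
  [/\ x + y - 1 <= g, g <= x, g <= y & 0 <= g] <-> g = x * y.
Proof.
move=> [->|->] [->|->]; split=> [[h1 h2 h3 h4]|->]; try split; lra.
Qed.

(** * The worst-case tail probability *)

Lemma odds_sqrt (R : rcfType) (alpha V : R) : 0 < alpha < 1 -> 0 < V ->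
  let t := Num.sqrt ((1 - alpha) / alpha * V) in
  0 < t /\ alpha * t ^+ 2 = (1 - alpha) * V.
Proof.
move=> /andP[al0 al1] V0 t.
have X0 : 0 < (1 - alpha) / alpha * V.
  by rewrite mulr_gt0// divr_gt0// subr_gt0.
rewrite /t sqrtr_gt0 sqr_sqrtr ?(ltW X0)//; split=> //.
by field; rewrite gt_eqF.
Qed.

(** Both the mean bound and the second moment bound are active in the extremal
    laws, which is why gamma1 <= alpha gamma2 is needed: otherwise the optimal
    shift is positive and a mean below the bound is worse. *)
Lemma robust_tail (R : realType) (n : nat) (mu : 'cV[R]_n) (Sigma : 'M[R]_n)
    (gamma1 gamma2 alpha b : R) :
  let S := quad_form Sigma (ones R n) in
  posdef Sigma -> 0 < S -> 0 <= gamma1 -> gamma1 < gamma2 ->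
  gamma1 <= alpha * gamma2 -> 0 < alpha < 1 ->
  (forall f, ambiguity_set mu Sigma gamma1 gamma2 f ->
     fine (f [set x | b < total_dev mu x]) <= alpha) <->
  Num.sqrt (gamma1 * S) +
    Num.sqrt ((1 - alpha) / alpha * ((gamma2 - gamma1) * S)) <= b.
Proof.
move=> S Spd S0 g1 g12 g12al al01; have /andP[al0 al1] := al01.
set a := Num.sqrt (gamma1 * S); set V := (gamma2 - gamma1) * S.
have V0 : 0 < V by rewrite mulr_gt0// subr_gt0.
have aE : a ^+ 2 = gamma1 * S by rewrite sqr_sqrtr// mulr_ge0// ltW.
have a0 : 0 <= a by exact: sqrtr_ge0.
split=> [robust|atb f Df]; last first.
  have [] := odds_sqrt al01 V0.
  set t := Num.sqrt _ in atb * => t0 tE.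
  have q0 : 0 < V / t by rewrite divr_gt0.
  set c := a - V / t.
  have c0 : c <= 0.
    apply: (optimal_shift_le0 al0 t0 V0 tE a0).
    rewrite aE /V !mulrA ler_pM2r//; lra.
  have cb : c < b.
    apply: lt_le_trans atb; rewrite /c; lra.
  have D0 : 0 < (b - c) ^+ 2 by rewrite exprn_gt0// subr_gt0.
  rewrite -(ler_pM2l D0) [leRHS]mulrC.
  apply: le_trans (optimal_shift_bound al0 t0 V0 tE atb).
  have -> : V + a ^+ 2 = gamma2 * S by rewrite aE /V; ring.
  exact: (total_dev_tail Spd Df c0 cb).
rewrite leNgt; apply/negP => bat.
have : b - a < Num.sqrt ((1 - alpha) / alpha * V) by rewrite ltrBlDl.
move=> /(exists_larger_level al01 V0)[p [/andP[alp p1] bp]].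
have p0 := lt_trans al0 alp.
have p01 : 0 < p < 1 by rewrite p0.
have [] := odds_sqrt p01 V0; set t := Num.sqrt _ in bp * => t0 tE.
have tn0 : t != 0 by rewrite gt_eqF.
have p01' : 0 <= p <= 1 by rewrite !ltW.
pose z := a - V / t.
(* Both identities are linear in p t ^ 2 - (1 - p) V, which is 0. *)
have meanE : p * (a + t) + (1 - p) * z = a.
  have -> : p * (a + t) + (1 - p) * z = a + (p * t ^+ 2 - (1 - p) * V) / t.
    by rewrite /z; field.
  by rewrite tE subrr mul0r addr0.
have secondE : p * (a + t) ^+ 2 + (1 - p) * z ^+ 2 = a ^+ 2 + V.
  have -> : p * (a + t) ^+ 2 + (1 - p) * z ^+ 2 = a ^+ 2 + V +
      (p * t ^+ 2 - (1 - p) * V) * (2 * a / t + 1 - V / t ^+ 2).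
    by rewrite /z; field.
  by rewrite tE subrr mul0r addr0.
have mean_le : (p * (a + t) + (1 - p) * z) ^+ 2 <= gamma1 * S.
  by rewrite meanE aE.
have second_le : p * (a + t) ^+ 2 + (1 - p) * z ^+ 2 <= gamma2 * S.
  by rewrite secondE aE /V -mulrDl addrC subrK.
have := robust _ (two_point_ambiguity mu Spd S0 p01' mean_le second_le).
rewrite two_pointE// !diracE mem_set; last first.
  by rewrite /= total_dev_worst_point// -ltrBlDl.
rewrite mule1 -EFinM -EFinD /= leNgt => /negP; apply.
apply: lt_le_trans alp _; rewrite lerDl mulr_ge0// subr_ge0 ltW//.
Qed.

Lemma safe_set_setC (R : realType) (n : nat) (mu : 'cV[R]_n) (load : R) :
  [set x : borel_vec R n | 0 <= load - \sum_(i < n) x i 0] =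
  ~` [set x | load - ((ones R n)^T *m mu) 0 0 < total_dev mu x].
Proof.
apply/seteqP; split => x /=; rewrite /total_dev sumrB ones_dot ltrD2r subr_ge0.
  by move=> le; apply/negP; rewrite -leNgt.
by move/negP; rewrite -leNgt.
Qed.

(** The complement of a tail event has probability 1 minus that of the event,
    so an infimum of at least 1 - alpha is a uniform bound on the tails. *)
Lemma drcc_tail (R : realType) (n : nat) (mu : 'cV[R]_n) (load alpha : R)
    (D : set (probability (borel_vec R n) R)) :
  ((1 - alpha)%:E <=
     ereal_inf [set f [set x : borel_vec R n |
                   (0 <= load - \sum_(i < n) x i 0)%R] | f in D])%E <->
  (forall f, D f ->
     fine (f [set x | load - ((ones R n)^T *m mu) 0 0 < total_dev mu x])
     <= alpha).
Proof.
rewrite (safe_set_setC mu); set b := load - _.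
have safeE (f : probability (borel_vec R n) R) :
    f (~` [set x | b < total_dev mu x]) =
    (1 - fine (f [set x | b < total_dev mu x]))%:E.
  have mT : measurable ([set x | b < total_dev mu x] : set (borel_vec R n)).
    by apply: measurable_upper_level; exact: measurable_total_dev.
  by rewrite probability_setC// EFinB fineK// fin_num_measure.
split=> [drcc f Df|tail].
  have : ((1 - alpha)%:E <= f (~` [set x | (b < total_dev mu x)%R]))%E.
    by apply: le_trans drcc _; apply: ereal_inf_lbound; exists f.
  by rewrite safeE lee_fin lerD2l lerN2.
apply: le_ereal_inf_tmp => _ [f Df <-].
by rewrite safeE lee_fin lerB// tail.
Qed.

(** * The chance constraint and its reformulation *)

Theorem theorem2 (R : realType) (NHVAC NPV : nat)
    (hNHVAC : (1 <= NHVAC)%N) (hNPV : (1 <= NPV)%N)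
    (P : 'cV[R]_NHVAC) (hP : forall l, 0 < P l 0)
    (mu : 'cV[R]_NPV) (Sigma : 'M[R]_NPV) (hSigma : posdef Sigma)
    (gamma1 gamma2 : R) (hgamma1 : 0 <= gamma1)
    (hgamma2 : Num.max gamma1 1 <= gamma2)
    (alpha : R) (halpha : 0 < alpha < 1) (hgamma : gamma1 / gamma2 <= alpha)
    (u : 'cV[R]_NHVAC) (hu : forall l, u l 0 = 0 \/ u l 0 = 1) :
  let theta := ((ones R NPV)^T *m mu) 0 0 in
  let sigma := Num.sqrt (quad_form Sigma (ones R NPV)) in
  let load := \sum_(l < NHVAC) P l 0 * u l 0 in
  let DRCC :=
    ((1 - alpha)%:E <=
       ereal_inf [set f [set x : borel_vec R NPV |
                     (0 <= load - \sum_(i < NPV) x i 0)%R]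
                 | f in ambiguity_set mu Sigma gamma1 gamma2])%E in
  let closed_form :=
    theta + (Num.sqrt gamma1
             + Num.sqrt ((1 - alpha) / alpha * (gamma2 - gamma1))) * sigma
      <= load in
  let reformulation :=
    exists (d : R) (g : 'M[R]_NHVAC),
      [/\ norm2 (col_mx (2 * sigma * Num.sqrt (gamma2 - gamma1))%:M
                        (alpha - d)%:M : 'cV[R]_(1 + 1)) <= alpha + d,
          d <= \sum_(i < NHVAC) \sum_(j < NHVAC) P i 0 * P j 0 * g i j
               - 2 * (theta + sigma * Num.sqrt gamma1) * load
               + theta ^+ 2 + 2 * theta * sigma * Num.sqrt gamma1
               + gamma2 * sigma ^+ 2,
          theta + sigma * Num.sqrt gamma1 <= load &
          forall i j : 'I_NHVAC,
            [/\ u i 0 + u j 0 - 1 <= g i j, g i j <= u i 0,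
                g i j <= u j 0 & 0 <= g i j]] in
  (DRCC <-> closed_form) /\ (DRCC <-> reformulation).
Proof.
move=> theta sigma load DRCC closed_form reformulation.
have /andP[al0 al1] := halpha.
have [g1g2 g2ge1] : gamma1 <= gamma2 /\ 1 <= gamma2.
  by move: hgamma2; rewrite ge_max => /andP.
have g2_gt0 : 0 < gamma2 by exact: lt_le_trans g2ge1.
have g1_le : gamma1 <= alpha * gamma2 by rewrite -ler_pdivrMr.
have g1_lt : gamma1 < gamma2.
  by apply: le_lt_trans g1_le _; rewrite gtr_pMl.
pose S := quad_form Sigma (ones R NPV).
have S_gt0 : 0 < S.
  apply: hSigma.2; apply/eqP => /matrixP/(_ (Ordinal hNPV) 0).
  by rewrite !mxE => /eqP; rewrite oner_eq0.
have sigma2 : sigma ^+ 2 = S by rewrite /sigma sqr_sqrtr// ltW.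
pose V := (gamma2 - gamma1) * S.
have V_gt0 : 0 < V by rewrite mulr_gt0// subr_gt0.
have aE : Num.sqrt (gamma1 * S) = sigma * Num.sqrt gamma1.
  by rewrite sqrtrM// mulrC.
set t := Num.sqrt ((1 - alpha) / alpha * V).
have tE : t = Num.sqrt ((1 - alpha) / alpha * (gamma2 - gamma1)) * sigma.
  rewrite /t /V mulrA sqrtrM// mulr_ge0// ?divr_ge0 ?subr_ge0//; exact: ltW.
have [t_gt0 t_sqr] := odds_sqrt halpha V_gt0; rewrite -/t in t_gt0 t_sqr.
pose r := load - theta - sigma * Num.sqrt gamma1.
have closedE : closed_form <-> t <= r.
  rewrite /closed_form /r mulrDl -tE (mulrC _ sigma) lerBrDl lerBrDl.
  by rewrite addrA.
have DRCC_closed : DRCC <-> closed_form.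
  rewrite closedE /DRCC (drcc_tail mu).
  rewrite (robust_tail mu _ hSigma S_gt0 hgamma1 g1_lt g1_le halpha).
  have -> : (t <= r) = (Num.sqrt (gamma1 * S) + t <= load - theta).
    by rewrite aE /r lerBrDl.
  by [].
split=> //; rewrite DRCC_closed closedE.
rewrite (exists_slack r al0 V_gt0 (ltW t_gt0) t_sqr).
have socE d : norm2 (col_mx (2 * sigma * Num.sqrt (gamma2 - gamma1))%:M
    (alpha - d)%:M : 'cV[R]_(1 + 1)) <= alpha + d <->
    0 <= alpha + d /\ 4 * V + (alpha - d) ^+ 2 <= (alpha + d) ^+ 2.
  rewrite norm2_pair_le !exprMn sigma2 sqr_sqrtr ?subr_ge0//.
  by have -> : 2 ^+ 2 * S * (gamma2 - gamma1) = 4 * V by rewrite /V; ring.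
have quadE : load ^+ 2 - 2 * (theta + sigma * Num.sqrt gamma1) * load
    + theta ^+ 2 + 2 * theta * sigma * Num.sqrt gamma1 + gamma2 * sigma ^+ 2 =
    r ^+ 2 + V.
  have a2 : (sigma * Num.sqrt gamma1) ^+ 2 = gamma1 * S.
    by rewrite exprMn sigma2 sqr_sqrtr// mulrC.
  have -> : V = gamma2 * sigma ^+ 2 - (sigma * Num.sqrt gamma1) ^+ 2.
    by rewrite a2 sigma2 /V; ring.
  by rewrite /r; ring.
have loadE (g : 'M[R]_NHVAC) : (forall i j, g i j = u i 0 * u j 0) ->
    \sum_(i < NHVAC) \sum_(j < NHVAC) P i 0 * P j 0 * g i j = load ^+ 2.
  move=> gE; rewrite expr2 mulr_suml; apply: eq_bigr => i _.
  by rewrite mulr_sumr; apply: eq_bigr => j _; rewrite gE; ring.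
have r_ge0 : (0 <= r) = (theta + sigma * Num.sqrt gamma1 <= load).
  by rewrite /r -addrA -opprD subr_ge0.
split=> [[d [/socE soc dle r0]]|[d [g [/socE soc dle r0 gE]]]].
  pose g : 'M[R]_NHVAC := \matrix_(i, j) (u i 0 * u j 0).
  exists d, g; split=> //; first by rewrite loadE ?quadE// => i j; rewrite mxE.
    by rewrite -r_ge0.
  by move=> i j; apply/mccormick_binary => //; rewrite mxE.
exists d; split=> //; last by rewrite r_ge0.
rewrite -quadE -(loadE g)// => i j.
exact/mccormick_binary.
Qed.
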